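(* Let $\mathcal V$ be a symmetric monoidal closed category, let $\mathbb T=(T,\eta,\mu)$ be a $\mathcal V$-monad on a $\mathcal V$-category $\mathcal B$, and let $F\dashv G:\mathcal C\to\mathcal B$ be any $\mathcal V$-adjunction inducing $\mathbb T$. Then the following are equivalent: (1) The terminal idempotent $\mathcal V$-monad over $\mathbb T$ exists. (2) The full sub-$\mathcal V$-category $T(\mathrm{Ob}\,\mathcal B)\hookrightarrow\mathcal B$ has a $\mathcal V$-reflective hull. (3) The full sub-$\mathcal V$-category $G(\mathrm{Ob}\,\mathcal C)\hookrightarrow\mathcal B$ has a $\mathcal V$-reflective hull. (4) There is a smallest $\mathcal V$-reflective-subcategory through which $F\dashv G$ factors. Further, given an idempotent $\mathcal V$-monad $\widetilde{\mathbb T}$ on $\mathcal B$ with associated $\mathcal V$-reflective-subcategory $\mathcal B'$, $\widetilde{\mathbb T}$ is a terminal idempotent $\mathcal V$-monad over $\mathbb T$ if and only if $\mathcal B'$ is a $\mathcal V$-reflective hull of $T(\mathrm{Ob}\,\mathcal B)$, resp. of $G(\mathrm{Ob}\,\mathcal C)$, equivalently, a smallest $\mathcal V$-reflective-subcategory through which $F\dashv G$ factors.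
   Context: No limits or colimits are assumed in $\mathcal V$. Categories are not assumed locally small. A $\mathcal V$-monad is idempotent if its multiplication is an isomorphism. A morphism of $\mathcal V$-monads on $\mathcal B$ is a $\mathcal V$-natural transformation of the underlying $\mathcal V$-endofunctors commuting with units and multiplications. A terminal idempotent $\mathcal V$-monad over $\mathbb T$ is an idempotent $\mathcal V$-monad $\widetilde{\mathbb T}$ on $\mathcal B$ for which there is a (necessarily unique) morphism of $\mathcal V$-monads $\iota:\widetilde{\mathbb T}\to\mathbb T$ such that for every morphism of $\mathcal V$-monads $\alpha:\mathbb S\to\mathbb T$ with $\mathbb S$ idempotent there is a unique morphism $\alpha_\sharp:\mathbb S\to\widetilde{\mathbb T}$ with $\iota\cdot\alpha_\sharp=\alpha$. A $\mathcal V$-reflective-subcategory of $\mathcal B$ is a full replete sub-$\mathcal V$-category $\mathcal B'$ whose inclusion has a left $\mathcal V$-adjoint. The one associated to an idempotent $\mathcal V$-monad with unit $\rho$ consists of those $B$ with $\rho_B$ an isomorphism. The $\mathcal V$-reflective hull of a full sub-$\mathcal V$-category of $\mathcal B$, if it exists, is the smallest (under inclusion) $\mathcal V$-reflective-subcategory of $\mathcal B$ containing it. $T(\mathrm{Ob}\,\mathcal B)$ and $G(\mathrm{Ob}\,\mathcal C)$ denote the full sub-$\mathcal V$-categories of $\mathcal B$ on the objects $TB$ ($B\in\mathcal B$), resp. $GC$ ($C\in\mathcal C$). The $\mathcal V$-adjunction $F\dashv G:\mathcal C\to\mathcal B$ factors through a $\mathcal V$-reflective-subcategory $\mathcal B'$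 if $GC\in\mathcal B'$ for all $C\in\mathcal C$ (in which case $F\dashv G$ is isomorphic to the composite of the reflection onto $\mathcal B'$ with a $\mathcal V$-adjunction between $\mathcal B'$ and $\mathcal C$). *)

(* Defs.v *)
From Corelib Require Import ssreflect ssrfun ssrbool.

Set Implicit Arguments.
Unset Strict Implicit.
Unset Printing Implicit Defensive.

Declare Scope cat_scope.
Delimit Scope cat_scope with cat.
Open Scope cat_scope.

Record Category := MkCategory {
  ob :> Type;
  Hom : ob -> ob -> Type;
  idm : forall X, Hom X X;
  comp : forall X Y Z, Hom Y Z -> Hom X Y -> Hom X Z;
  comp_idl : forall X Y (f : Hom X Y), comp (idm Y) f = f;
  comp_idr : forall X Y (f : Hom X Y), comp f (idm X) = f;
  comp_assoc : forall W X Y Z (h : Hom Y Z) (g : Hom X Y) (f : Hom W X),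
    comp (comp h g) f = comp h (comp g f)
}.

Arguments Hom {c} X Y.
Arguments idm {c} X.

Notation "g ∘ f" := (comp g f) (at level 50, left associativity) : cat_scope.

Definition inverses (K : Category) (X Y : K) (f : Hom X Y) (g : Hom Y X) : Prop :=
  g ∘ f = idm X /\ f ∘ g = idm Y.

Definition is_iso (K : Category) (X Y : K) (f : Hom X Y) : Prop :=
  exists g : Hom Y X, inverses f g.

Definition isomorphic (K : Category) (X Y : K) : Prop :=
  exists f : Hom X Y, is_iso f.

Record MonoidalCategory := MkMonoidalCategory {
  mon_cat :> Category;
  tens : mon_cat -> mon_cat -> mon_cat;
  tensm : forall X X' Y Y' : mon_cat,
    Hom X X' -> Hom Y Y' -> Hom (tens X Y) (tens X' Y');
  tunit : mon_cat;
  tassoc : forall X Y Z : mon_cat, Hom (tens (tens X Y) Z) (tens X (tens Y Z));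
  tassoc_inv : forall X Y Z : mon_cat, Hom (tens X (tens Y Z)) (tens (tens X Y) Z);
  lunit : forall X : mon_cat, Hom (tens tunit X) X;
  lunit_inv : forall X : mon_cat, Hom X (tens tunit X);
  runit : forall X : mon_cat, Hom (tens X tunit) X;
  runit_inv : forall X : mon_cat, Hom X (tens X tunit);
  tensm_id : forall X Y : mon_cat, tensm (idm X) (idm Y) = idm (tens X Y);
  tensm_comp : forall (X X' X'' Y Y' Y'' : mon_cat)
    (f' : Hom X' X'') (f : Hom X X') (g' : Hom Y' Y'') (g : Hom Y Y'),
    tensm (f' ∘ f) (g' ∘ g) = tensm f' g' ∘ tensm f g;
  tassocK : forall X Y Z, inverses (tassoc X Y Z) (tassoc_inv X Y Z);
  lunitK : forall X, inverses (lunit X) (lunit_inv X);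
  runitK : forall X, inverses (runit X) (runit_inv X);
  tassoc_nat : forall (X X' Y Y' Z Z' : mon_cat)
    (f : Hom X X') (g : Hom Y Y') (h : Hom Z Z'),
    tassoc X' Y' Z' ∘ tensm (tensm f g) h = tensm f (tensm g h) ∘ tassoc X Y Z;
  lunit_nat : forall (X X' : mon_cat) (f : Hom X X'),
    lunit X' ∘ tensm (idm tunit) f = f ∘ lunit X;
  runit_nat : forall (X X' : mon_cat) (f : Hom X X'),
    runit X' ∘ tensm f (idm tunit) = f ∘ runit X;
  pentagon : forall W X Y Z : mon_cat,
    tassoc W X (tens Y Z) ∘ tassoc (tens W X) Y Z
    = tensm (idm W) (tassoc X Y Z) ∘ tassoc W (tens X Y) Z
        ∘ tensm (tassoc W X Y) (idm Z);
  triangle : forall X Y : mon_cat,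
    tensm (idm X) (lunit Y) ∘ tassoc X tunit Y = tensm (runit X) (idm Y)
}.

Arguments tunit {m}.
Arguments tassoc {m} X Y Z.
Arguments tassoc_inv {m} X Y Z.
Arguments lunit {m} X.
Arguments lunit_inv {m} X.
Arguments runit {m} X.
Arguments runit_inv {m} X.

Notation "X ⊗ Y" := (tens X Y) (at level 40, left associativity) : cat_scope.
Notation "f ⊠ g" := (tensm f g) (at level 40, left associativity) : cat_scope.

Record SymMonClosedCategory := MkSymMonClosedCategory {
  smc_mon :> MonoidalCategory;
  braid : forall X Y : smc_mon, Hom (X ⊗ Y) (Y ⊗ X);
  braid_nat : forall (X X' Y Y' : smc_mon) (f : Hom X X') (g : Hom Y Y'),
    braid X' Y' ∘ (f ⊠ g) = (g ⊠ f) ∘ braid X Y;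
  braid_sym : forall X Y : smc_mon, braid Y X ∘ braid X Y = idm (X ⊗ Y);
  hexagon : forall X Y Z : smc_mon,
    tassoc Y Z X ∘ braid X (Y ⊗ Z) ∘ tassoc X Y Z
    = (idm Y ⊠ braid X Z) ∘ tassoc Y X Z ∘ (braid X Y ⊠ idm Z);
  ihom : smc_mon -> smc_mon -> smc_mon;
  eval : forall Y Z : smc_mon, Hom (ihom Y Z ⊗ Y) Z;
  curry : forall X Y Z : smc_mon, Hom (X ⊗ Y) Z -> Hom X (ihom Y Z);
  eval_curry : forall (X Y Z : smc_mon) (f : Hom (X ⊗ Y) Z),
    eval Y Z ∘ (curry f ⊠ idm Y) = f;
  curry_uniq : forall (X Y Z : smc_mon) (f : Hom (X ⊗ Y) Z) (g : Hom X (ihom Y Z)),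
    eval Y Z ∘ (g ⊠ idm Y) = f -> g = curry f
}.

Section Coherence.
Variable V : MonoidalCategory.
Implicit Types X Y Z W : V.

Lemma lunit_l X : lunit_inv X ∘ lunit X = idm _.
Proof. by case: (lunitK X). Qed.
Lemma lunit_r X : lunit X ∘ lunit_inv X = idm _.
Proof. by case: (lunitK X). Qed.
Lemma runit_l X : runit_inv X ∘ runit X = idm _.
Proof. by case: (runitK X). Qed.
Lemma runit_r X : runit X ∘ runit_inv X = idm _.
Proof. by case: (runitK X). Qed.
Lemma tassoc_l X Y Z : tassoc_inv X Y Z ∘ tassoc X Y Z = idm _.
Proof. by case: (tassocK X Y Z). Qed.
Lemma tassoc_r X Y Z : tassoc X Y Z ∘ tassoc_inv X Y Z = idm _.
Proof. by case: (tassocK X Y Z). Qed.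

Lemma comp_cancel_r (K : Category) (X Y Z : K) (f : Hom X Y) (f' : Hom Y X)
  (g h : Hom Y Z) : f ∘ f' = idm Y -> g ∘ f = h ∘ f -> g = h.
Proof.
by move=> ff' e; rewrite -(comp_idr g) -(comp_idr h) -ff' -!comp_assoc e.
Qed.

Lemma comp_cancel_l (K : Category) (X Y Z : K) (f : Hom Y Z) (f' : Hom Z Y)
  (g h : Hom X Y) : f' ∘ f = idm Y -> f ∘ g = f ∘ h -> g = h.
Proof.
by move=> ff' e; rewrite -(comp_idl g) -(comp_idl h) -ff' !comp_assoc e.
Qed.

Lemma tens_comp1 X Y Y' Y'' (g : Hom Y' Y'') (f : Hom Y Y') :
  idm X ⊠ (g ∘ f) = (idm X ⊠ g) ∘ (idm X ⊠ f).
Proof. by rewrite -tensm_comp comp_idl. Qed.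

Lemma comp_tens1 X Y Y' Y'' (g : Hom Y' Y'') (f : Hom Y Y') :
  (g ∘ f) ⊠ idm X = (g ⊠ idm X) ∘ (f ⊠ idm X).
Proof. by rewrite -tensm_comp comp_idl. Qed.

Lemma tensm_lr X X' Y Y' (f : Hom X X') (g : Hom Y Y') :
  (f ⊠ idm Y') ∘ (idm X ⊠ g) = f ⊠ g.
Proof. by rewrite -tensm_comp comp_idl comp_idr. Qed.

Lemma tensm_rl X X' Y Y' (f : Hom X X') (g : Hom Y Y') :
  (idm X' ⊠ g) ∘ (f ⊠ idm Y) = f ⊠ g.
Proof. by rewrite -tensm_comp comp_idl comp_idr. Qed.

Lemma lunit_faithful X Y (f g : Hom X Y) : idm tunit ⊠ f = idm tunit ⊠ g -> f = g.
Proof.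
by move=> e; apply: (comp_cancel_r (lunit_r X)); rewrite -!lunit_nat e.
Qed.

Lemma runit_faithful X Y (f g : Hom X Y) : f ⊠ idm tunit = g ⊠ idm tunit -> f = g.
Proof.
by move=> e; apply: (comp_cancel_r (runit_r X)); rewrite -!runit_nat e.
Qed.

Lemma lunit_tens X Y : lunit (X ⊗ Y) ∘ tassoc tunit X Y = lunit X ⊠ idm Y.
Proof.
apply: lunit_faithful.
apply: (comp_cancel_r (tassoc_r tunit (tunit ⊗ X) Y)).
apply: (@comp_cancel_r _ _ _ _ (tassoc tunit tunit X ⊠ idm Y)
          (tassoc_inv tunit tunit X ⊠ idm Y)).
  by rewrite -comp_tens1 tassoc_r tensm_id.
rewrite tens_comp1 [LHS]comp_assoc [LHS]comp_assoc.
rewrite -[_ ∘ (_ ∘ (_ ⊠ idm Y))]comp_assoc -pentagon -comp_assoc triangle.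
rewrite -tassoc_nat comp_assoc -comp_tens1 triangle.
by rewrite tassoc_nat tensm_id.
Qed.

Lemma runit_tens X Y : (idm X ⊠ runit Y) ∘ tassoc X Y tunit = runit (X ⊗ Y).
Proof.
apply: runit_faithful.
apply: (comp_cancel_l (tassoc_l X Y tunit)).
rewrite comp_tens1 -comp_assoc tassoc_nat -triangle tens_comp1.
rewrite 2!comp_assoc -[_ ∘ (_ ∘ (_ ⊠ idm tunit))]comp_assoc -pentagon.
by rewrite -comp_assoc -tassoc_nat comp_assoc tensm_id triangle.
Qed.

Lemma lunit_runit_tunit : lunit (@tunit V) = runit tunit.
Proof.
apply: runit_faithful; rewrite -lunit_tens -triangle; congr (_ ∘ _).
by apply: (comp_cancel_l (lunit_l _)); rewrite lunit_nat.
Qed.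

Lemma lunit_inv_runit_inv : lunit_inv (@tunit V) = runit_inv tunit.
Proof.
apply: (comp_cancel_l (lunit_l _)).
by rewrite lunit_r lunit_runit_tunit runit_r.
Qed.

Lemma lunit_inv_nat X Y (f : Hom X Y) :
  lunit_inv Y ∘ f = (idm tunit ⊠ f) ∘ lunit_inv X.
Proof.
apply: (comp_cancel_l (lunit_l _)).
by rewrite -!comp_assoc lunit_r lunit_nat comp_assoc lunit_r comp_idl comp_idr.
Qed.

Lemma runit_inv_nat X Y (f : Hom X Y) :
  runit_inv Y ∘ f = (f ⊠ idm tunit) ∘ runit_inv X.
Proof.
apply: (comp_cancel_l (runit_l _)).
by rewrite -!comp_assoc runit_r runit_nat comp_assoc runit_r comp_idl comp_idr.
Qed.

Lemma lunit_inv_tens X Y :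
  tassoc tunit X Y ∘ (lunit_inv X ⊠ idm Y) = lunit_inv (X ⊗ Y).
Proof.
apply: (comp_cancel_l (lunit_l _)).
by rewrite -comp_assoc lunit_tens -comp_tens1 !lunit_r tensm_id.
Qed.

Lemma runit_inv_tens X Y :
  tassoc X Y tunit ∘ runit_inv (X ⊗ Y) = idm X ⊠ runit_inv Y.
Proof.
apply: (@comp_cancel_l _ _ _ _ (idm X ⊠ runit Y) (idm X ⊠ runit_inv Y)).
  by rewrite -tens_comp1 runit_l tensm_id.
by rewrite -comp_assoc runit_tens -tens_comp1 !runit_r tensm_id.
Qed.

End Coherence.

Record VCat (V : SymMonClosedCategory) := MkVCat {
  vob :> Type;
  vhom : vob -> vob -> V;
  vid : forall X, Hom tunit (vhom X X);
  vcomp : forall X Y Z, Hom (vhom Y Z ⊗ vhom X Y) (vhom X Z);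
  vcomp_assoc : forall W X Y Z,
    vcomp W Y Z ∘ (idm (vhom Y Z) ⊠ vcomp W X Y)
        ∘ tassoc (vhom Y Z) (vhom X Y) (vhom W X)
    = vcomp W X Z ∘ (vcomp X Y Z ⊠ idm (vhom W X));
  vcomp_idl : forall X Y,
    vcomp X Y Y ∘ (vid Y ⊠ idm (vhom X Y)) = lunit (vhom X Y);
  vcomp_idr : forall X Y,
    vcomp X X Y ∘ (idm (vhom X Y) ⊠ vid X) = runit (vhom X Y)
}.

Arguments vid {V v} X.
Arguments vcomp {V v} X Y Z.

Section Underlying.
Variables (V : SymMonClosedCategory) (B : VCat V).
Implicit Types X Y Z W : B.

Definition ecomp X Y Z (g : Hom tunit (vhom Y Z)) (f : Hom tunit (vhom X Y)) :
    Hom tunit (vhom X Z) :=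
  vcomp X Y Z ∘ (g ⊠ f) ∘ lunit_inv tunit.

(* The maps [B(W, g) : B(W, X) -> B(W, Y)] and [B(f, W) : B(Y, W) -> B(X, W)]. *)
Definition post W X Y (g : Hom tunit (vhom X Y)) : Hom (vhom W X) (vhom W Y) :=
  vcomp W X Y ∘ (g ⊠ idm _) ∘ lunit_inv _.

Definition pre X Y W (f : Hom tunit (vhom X Y)) : Hom (vhom Y W) (vhom X W) :=
  vcomp X Y W ∘ (idm _ ⊠ f) ∘ runit_inv _.

Lemma ecomp_post X Y Z (g : Hom tunit (vhom Y Z)) (f : Hom tunit (vhom X Y)) :
  ecomp g f = post X g ∘ f.
Proof.
by rewrite /ecomp /post [RHS]comp_assoc lunit_inv_nat -[RHS]comp_assoc
  [_ ∘ _ ∘ (idm _ ⊠ f)]comp_assoc tensm_lr.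
Qed.

Lemma ecomp_pre X Y Z (g : Hom tunit (vhom Y Z)) (f : Hom tunit (vhom X Y)) :
  ecomp g f = pre Z f ∘ g.
Proof.
by rewrite /ecomp /pre [RHS]comp_assoc runit_inv_nat -[RHS]comp_assoc
  [_ ∘ _ ∘ (g ⊠ idm _)]comp_assoc tensm_rl lunit_inv_runit_inv.
Qed.

Lemma post_id W X : post W (vid X) = idm _.
Proof. by rewrite /post vcomp_idl lunit_r. Qed.

Lemma pre_id X W : pre W (vid X) = idm _.
Proof. by rewrite /pre vcomp_idr runit_r. Qed.

Lemma post_vcomp W X Y Z (g : Hom tunit (vhom Y Z)) :
  post W g ∘ vcomp W X Y = vcomp W X Z ∘ (post X g ⊠ idm _).
Proof.
rewrite /post comp_assoc lunit_inv_nat -comp_assoc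
  [_ ∘ _ ∘ (idm _ ⊠ _)]comp_assoc tensm_lr -tensm_rl.
rewrite -lunit_inv_tens -comp_assoc [_ ∘ tassoc _ _ _]comp_assoc.
rewrite [_ ∘ tassoc _ _ _]comp_assoc -(tensm_id (vhom X Y)) -tassoc_nat.
by rewrite -!comp_assoc vcomp_assoc !comp_tens1 -!comp_assoc.
Qed.

Lemma pre_vcomp W X Y Z (f : Hom tunit (vhom W X)) :
  pre Z f ∘ vcomp X Y Z = vcomp W Y Z ∘ (idm _ ⊠ pre Y f).
Proof.
rewrite /pre comp_assoc runit_inv_nat -comp_assoc
  [_ ∘ _ ∘ (_ ⊠ idm _)]comp_assoc tensm_rl -tensm_lr -comp_assoc -vcomp_assoc.
rewrite -(tensm_id (vhom Y Z) (vhom X Y)) [_ ∘ tassoc _ _ _ ∘ _]comp_assoc tassoc_nat.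
by rewrite !comp_assoc runit_inv_tens !tens_comp1.
Qed.

Lemma post_comp W X Y Z (g : Hom tunit (vhom Y Z)) (f : Hom tunit (vhom X Y)) :
  post W (ecomp g f) = post W g ∘ post W f.
Proof.
rewrite {3}/post -!comp_assoc post_vcomp [_ ∘ _ ∘ (f ⊠ _)]comp_assoc -comp_tens1.
by rewrite -ecomp_post.
Qed.

Lemma pre_comp W X Y Z (g : Hom tunit (vhom Y Z)) (f : Hom tunit (vhom X Y)) :
  pre W (ecomp g f) = pre W f ∘ pre W g.
Proof.
rewrite {3}/pre -!comp_assoc pre_vcomp [_ ∘ _ ∘ (_ ⊠ g)]comp_assoc -tens_comp1.
by rewrite -ecomp_pre.
Qed.

Lemma post_pre X Y Z W (g : Hom tunit (vhom Z W)) (f : Hom tunit (vhom X Y)) :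
  post X g ∘ pre Z f = pre W f ∘ post Y g.
Proof.
rewrite /pre -[LHS]comp_assoc -[post X g ∘ (_ ∘ _)]comp_assoc post_vcomp [_ ∘ _ ∘ (_ ⊠ f)]comp_assoc tensm_lr.
rewrite [RHS]comp_assoc runit_inv_nat -[RHS]comp_assoc.
by rewrite [_ ∘ _ ∘ (post Y g ⊠ idm _)]comp_assoc tensm_rl.
Qed.

Lemma ecomp_idl X Y (f : Hom tunit (vhom X Y)) : ecomp (vid Y) f = f.
Proof. by rewrite ecomp_post post_id comp_idl. Qed.

Lemma ecomp_idr X Y (f : Hom tunit (vhom X Y)) : ecomp f (vid X) = f.
Proof. by rewrite ecomp_pre pre_id comp_idl. Qed.

Lemma ecomp_assoc W X Y Z (h : Hom tunit (vhom Y Z)) (g : Hom tunit (vhom X Y))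
  (f : Hom tunit (vhom W X)) : ecomp (ecomp h g) f = ecomp h (ecomp g f).
Proof. by rewrite !ecomp_post -comp_assoc -post_comp ecomp_post. Qed.

Definition underlying : Category :=
  @MkCategory B (fun X Y => Hom tunit (vhom X Y)) (fun X => vid X) ecomp
    ecomp_idl ecomp_idr ecomp_assoc.

End Underlying.

Record VFunctor (V : SymMonClosedCategory) (A B : VCat V) := MkVFunctor {
  fob :> A -> B;
  fhom : forall X Y : A, Hom (vhom X Y) (vhom (fob X) (fob Y));
  fhom_id : forall X : A, fhom X X ∘ vid X = vid (fob X);
  fhom_comp : forall X Y Z : A,
    fhom X Z ∘ vcomp X Y Z
    = vcomp (fob X) (fob Y) (fob Z) ∘ (fhom Y Z ⊠ fhom X Y)
}.

Section Functors.
Variable V : SymMonClosedCategory.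

Definition fmap (A B : VCat V) (F : VFunctor A B) (X Y : A)
    (f : @Hom (underlying A) X Y) : @Hom (underlying B) (F X) (F Y) :=
  fhom F X Y ∘ (f : Hom tunit (vhom X Y)).

Lemma fmap_id (A B : VCat V) (F : VFunctor A B) (X : A) :
  fmap F (@idm (underlying A) X) = @idm (underlying B) (F X).
Proof. exact: fhom_id. Qed.

Lemma fmap_comp (A B : VCat V) (F : VFunctor A B) (X Y Z : A)
  (g : @Hom (underlying A) Y Z) (f : @Hom (underlying A) X Y) :
  fmap F (g ∘ f) = fmap F g ∘ fmap F f.
Proof.
rewrite /fmap /= /ecomp -!comp_assoc fhom_comp.
by rewrite [_ ∘ (_ ⊠ _) ∘ (g ⊠ f)]comp_assoc -tensm_comp.
Qed.

Lemma fhom_post (A B : VCat V) (F : VFunctor A B) (W X Y : A)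
  (g : @Hom (underlying A) X Y) :
  fhom F W Y ∘ post W g = post (F W) (fmap F g) ∘ fhom F W X.
Proof.
rewrite /post -!comp_assoc fhom_comp [_ ∘ _ ∘ (g ⊠ _)]comp_assoc.
rewrite -tensm_comp comp_idr comp_assoc [RHS]comp_assoc lunit_inv_nat.
by rewrite -[RHS]comp_assoc [_ ∘ (idm _ ⊠ _)]comp_assoc tensm_lr comp_assoc.
Qed.

Lemma fhom_pre (A B : VCat V) (F : VFunctor A B) (X Y W : A)
  (f : @Hom (underlying A) X Y) :
  fhom F X W ∘ pre W f = pre (F W) (fmap F f) ∘ fhom F Y W.
Proof.
rewrite /pre -!comp_assoc fhom_comp [_ ∘ _ ∘ (_ ⊠ f)]comp_assoc.
rewrite -tensm_comp comp_idr comp_assoc [RHS]comp_assoc runit_inv_nat.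
by rewrite -[RHS]comp_assoc [_ ∘ (_ ⊠ idm _)]comp_assoc tensm_rl comp_assoc.
Qed.

Definition fid (A : VCat V) : VFunctor A A.
Proof.
refine (@MkVFunctor V A A (fun X => X) (fun X Y => idm _) _ _).
- by move=> X; rewrite comp_idl.
- by move=> X Y Z; rewrite comp_idl tensm_id comp_idr.
Defined.

Definition fcomp (A B C : VCat V) (G : VFunctor B C) (F : VFunctor A B) :
  VFunctor A C.
Proof.
refine (@MkVFunctor V A C (fun X => G (F X))
  (fun X Y => fhom G (F X) (F Y) ∘ fhom F X Y) _ _).
- by move=> X; rewrite comp_assoc !fhom_id.
- move=> X Y Z.
  by rewrite comp_assoc fhom_comp -comp_assoc fhom_comp comp_assoc -tensm_comp.
Defined.

Lemma fmap_fcomp (A B C : VCat V) (G : VFunctor B C) (F : VFunctor A B) (X Y : A)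
  (f : @Hom (underlying A) X Y) : fmap (fcomp G F) f = fmap G (fmap F f).
Proof. by rewrite /fmap /= comp_assoc. Qed.

End Functors.

Section NatTrans.
Variable V : SymMonClosedCategory.

Record VNat (A B : VCat V) (F G : VFunctor A B) := MkVNat {
  ncomp :> forall X : A, @Hom (underlying B) (F X) (G X);
  vnaturality : forall X Y : A,
    vcomp (F X) (F Y) (G Y) ∘ (ncomp Y ⊠ fhom F X Y) ∘ lunit_inv (vhom X Y)
    = vcomp (F X) (G X) (G Y) ∘ (fhom G X Y ⊠ ncomp X) ∘ runit_inv (vhom X Y)
}.

Lemma vnat_post_pre (A B : VCat V) (F G : VFunctor A B)
    (a : forall X : A, @Hom (underlying B) (F X) (G X)) (X Y : A) :
  (vcomp (F X) (F Y) (G Y) ∘ (a Y ⊠ fhom F X Y) ∘ lunit_inv (vhom X Y)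
   = vcomp (F X) (G X) (G Y) ∘ (fhom G X Y ⊠ a X) ∘ runit_inv (vhom X Y))
  <-> post (F X) (a Y) ∘ fhom F X Y = pre (G Y) (a X) ∘ fhom G X Y.
Proof.
have -> : post (F X) (a Y) ∘ fhom F X Y
    = vcomp (F X) (F Y) (G Y) ∘ (a Y ⊠ fhom F X Y) ∘ lunit_inv (vhom X Y).
  rewrite /post comp_assoc lunit_inv_nat -comp_assoc.
  by rewrite [_ ∘ _ ∘ (idm _ ⊠ fhom F X Y)]comp_assoc tensm_lr.
have -> // : pre (G Y) (a X) ∘ fhom G X Y
    = vcomp (F X) (G X) (G Y) ∘ (fhom G X Y ⊠ a X) ∘ runit_inv (vhom X Y).
rewrite /pre comp_assoc runit_inv_nat -comp_assoc.
by rewrite [_ ∘ _ ∘ (fhom G X Y ⊠ idm _)]comp_assoc tensm_rl.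
Qed.

Lemma vnatP (A B : VCat V) (F G : VFunctor A B) (a : VNat F G) (X Y : A) :
  post (F X) (a Y) ∘ fhom F X Y = pre (G Y) (a X) ∘ fhom G X Y.
Proof. exact/vnat_post_pre/vnaturality. Qed.

Definition mkVNat (A B : VCat V) (F G : VFunctor A B)
    (a : forall X : A, @Hom (underlying B) (F X) (G X))
    (aP : forall X Y : A,
      post (F X) (a Y) ∘ fhom F X Y = pre (G Y) (a X) ∘ fhom G X Y) : VNat F G :=
  @MkVNat A B F G a (fun X Y => proj2 (@vnat_post_pre A B F G a X Y) (aP X Y)).

Lemma vnat_underlying (A B : VCat V) (F G : VFunctor A B) (a : VNat F G) (X Y : A)
  (f : @Hom (underlying A) X Y) : a Y ∘ fmap F f = fmap G f ∘ a X.
Proof.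
change (ecomp (a Y) (fmap F f) = ecomp (fmap G f) (a X)).
by rewrite ecomp_post ecomp_pre /fmap -!comp_assoc vnatP.
Qed.

Definition nid (A B : VCat V) (F : VFunctor A B) : VNat F F.
Proof.
refine (@mkVNat A B F F (fun X => @idm (underlying B) (F X)) _).
by move=> X Y /=; rewrite post_id pre_id.
Defined.

Definition nvcomp (A B : VCat V) (F G H : VFunctor A B) (b : VNat G H) (a : VNat F G) :
  VNat F H.
Proof.
refine (@mkVNat A B F H (fun X => b X ∘ a X) _).
move=> X Y /=.
by rewrite post_comp comp_assoc vnatP -comp_assoc post_pre comp_assoc vnatP
  -comp_assoc -pre_comp.
Defined.

Definition vnat_is_iso (A B : VCat V) (F G : VFunctor A B) (a : VNat F G) : Prop :=
  exists b : VNat G F, nvcomp b a = nid F /\ nvcomp a b = nid G.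

End NatTrans.

Section AdjunctionsMonads.
Variable V : SymMonClosedCategory.
Local Opaque post pre.

Record VAdjunction (B C : VCat V) (F : VFunctor B C) (G : VFunctor C B) := MkVAdjunction {
  adj_unit : VNat (fid B) (fcomp G F);
  adj_counit : VNat (fcomp F G) (fid C);
  adj_triangle_l : forall X : B,
    (adj_counit (F X) : @Hom (underlying C) (F (G (F X))) (F X)) ∘ fmap F (adj_unit X)
    = idm _;
  adj_triangle_r : forall Y : C,
    fmap G (adj_counit Y) ∘ (adj_unit (G Y) : @Hom (underlying B) (G Y) (G (F (G Y))))
    = idm _
}.

Record VMonad (B : VCat V) := MkVMonad {
  mfun :> VFunctor B B;
  munit : VNat (fid B) mfun;
  mmult : VNat (fcomp mfun mfun) mfun;
  mmult_unit_l : forall X : B,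
    (mmult X : @Hom (underlying B) (mfun (mfun X)) (mfun X)) ∘ munit (mfun X) = idm _;
  mmult_unit_r : forall X : B,
    (mmult X : @Hom (underlying B) (mfun (mfun X)) (mfun X)) ∘ fmap mfun (munit X)
    = idm _;
  mmult_assoc : forall X : B,
    (mmult X : @Hom (underlying B) (mfun (mfun X)) (mfun X)) ∘ mmult (mfun X)
    = (mmult X : @Hom (underlying B) (mfun (mfun X)) (mfun X)) ∘ fmap mfun (mmult X)
}.

Definition induced_mult (B C : VCat V) (F : VFunctor B C) (G : VFunctor C B)
  (adj : VAdjunction F G) : VNat (fcomp (fcomp G F) (fcomp G F)) (fcomp G F).
Proof.
refine (@mkVNat V B B (fcomp (fcomp G F) (fcomp G F)) (fcomp G F)
  (fun X => fmap G (adj_counit adj (F X))) _).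
move=> X Y /=.
rewrite -!comp_assoc -(fhom_post G) -(fhom_pre G) !comp_assoc; congr (_ ∘ _).
have /= e := vnatP (adj_counit adj) (F X) (F Y).
rewrite comp_idr in e.
by rewrite -!comp_assoc in e *; rewrite e.
Defined.

Definition induced_monad (B C : VCat V) (F : VFunctor B C) (G : VFunctor C B)
  (adj : VAdjunction F G) : VMonad B.
Proof.
refine (@MkVMonad B (fcomp G F) (adj_unit adj) (induced_mult adj) _ _ _).
- by move=> X; apply: (adj_triangle_r adj (F X)).
- move=> X; rewrite fmap_fcomp.
  have <- := fmap_id G (F X).
  by rewrite -(adj_triangle_l adj X) fmap_comp.
- move=> X; rewrite fmap_fcomp /=.
  have e := vnat_underlying (adj_counit adj) (adj_counit adj (F X)).
  rewrite fmap_fcomp in e.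
  have i Z W (f : @Hom (underlying C) Z W) : fmap (fid C) f = f.
    by rewrite /fmap /= comp_idl.
  rewrite i in e.
  have e' := f_equal (fmap G (X := _) (Y := _)) e.
  by rewrite !fmap_comp in e'; symmetry; exact: e'.
Defined.

Definition idempotent (B : VCat V) (T : VMonad B) : Prop := vnat_is_iso (mmult T).

(* The second equation uses the horizontal composite [T a ∘ a S] of [a] with itself. *)
Record VMonadMorphism (B : VCat V) (S T : VMonad B) := MkVMonadMorphism {
  mmor :> VNat S T;
  mmor_unit : forall X : B, mmor X ∘ munit S X = munit T X;
  mmor_mult : forall X : B,
    mmor X ∘ (mmult S X : @Hom (underlying B) (S (S X)) (S X))
    = (mmult T X : @Hom (underlying B) (T (T X)) (T X)) ∘ (fmap T (mmor X) ∘ mmor (S X))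
}.

Definition terminal_idempotent (B : VCat V) (T T' : VMonad B) : Prop :=
  idempotent T' /\
  exists iota : VMonadMorphism T' T,
    forall (S : VMonad B) (alpha : VMonadMorphism S T), idempotent S ->
      exists! alpha' : VMonadMorphism S T', nvcomp iota alpha' = alpha.

End AdjunctionsMonads.

Section FullSubcategories.
Variable V : SymMonClosedCategory.
Variable B : VCat V.

(* A full sub-[V]-category of [B] is given by a predicate on the objects of [B]. *)
Definition fullsub (P : B -> Prop) : VCat V :=
  @MkVCat V {X : B | P X}
    (fun X Y => vhom (proj1_sig X) (proj1_sig Y))
    (fun X => vid (proj1_sig X))
    (fun X Y Z => vcomp (proj1_sig X) (proj1_sig Y) (proj1_sig Z))
    (fun W X Y Z => vcomp_assoc (proj1_sig W) (proj1_sig X) (proj1_sig Y) (proj1_sig Z))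
    (fun X Y => vcomp_idl (proj1_sig X) (proj1_sig Y))
    (fun X Y => vcomp_idr (proj1_sig X) (proj1_sig Y)).

Definition fullsub_incl (P : B -> Prop) : VFunctor (fullsub P) B.
Proof.
refine (@MkVFunctor V (fullsub P) B (fun X => proj1_sig X) (fun X Y => idm _) _ _).
- by move=> X; rewrite comp_idl.
- by move=> X Y Z; rewrite comp_idl tensm_id comp_idr.
Defined.

Definition subcat_le (P Q : B -> Prop) : Prop := forall X, P X -> Q X.

Definition replete (P : B -> Prop) : Prop :=
  forall X Y : B, @isomorphic (underlying B) X Y -> P X -> P Y.

Definition reflective_subcat (P : B -> Prop) : Prop :=
  replete P /\
  exists L : VFunctor B (fullsub P), inhabited (VAdjunction L (fullsub_incl P)).

Definition reflective_hull (S P : B -> Prop) : Prop :=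
  [/\ reflective_subcat P, subcat_le S P &
      forall Q : B -> Prop, reflective_subcat Q -> subcat_le S Q -> subcat_le P Q].

Definition assoc_subcat (T : VMonad B) : B -> Prop :=
  fun X => @is_iso (underlying B) X (T X) (munit T X).

(* The objects of the form [H A], with no closure under isomorphism. *)
Definition ob_image (A : VCat V) (H : VFunctor A B) : B -> Prop :=
  fun X => exists Y : A, X = H Y.

Definition factors_through (C : VCat V) (F : VFunctor B C) (G : VFunctor C B)
    (adj : VAdjunction F G) (P : B -> Prop) : Prop :=
  forall Y : C, P (G Y).

Definition smallest_factoring (C : VCat V) (F : VFunctor B C) (G : VFunctor C B)
    (adj : VAdjunction F G) (P : B -> Prop) : Prop :=
  [/\ reflective_subcat P, factors_through adj P &
      forall Q : B -> Prop,
        reflective_subcat Q -> factors_through adj Q -> subcat_le P Q].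

End FullSubcategories.

(* Main.v *)
From Corelib Require Import ssreflect ssrfun ssrbool.
From Stdlib Require Import FunctionalExtensionality ProofIrrelevance IndefiniteDescription.
Require Import Defs.

(** Both sides of the theorem are statements about one order. Idempotent
    V-monads on B and V-reflective-subcategories of B correspond to each other:
    the objects at which the unit of an idempotent monad is invertible form a
    reflective subcategory ([assoc_subcat_reflective]), and every reflective
    subcategory arises so from the monad that its reflection induces
    ([reflective_subcat_monad]). What makes the correspondence useful here is
    that, for S idempotent and T any V-monad, there is at most one morphism of
    V-monads from S to T, and there is one exactly when every TX lies in the
    reflective subcategory of S ([monad_morphism_ob_image],
    [monad_morphism_exists], [vnat_unit_unique]). Taking T idempotent as well,
    the correspondence reverses the order: S maps to T' if and only if the
    subcategory of T' is contained in that of S. So an idempotent monad that is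
    terminal among those over T is the same thing as a smallest reflective
    subcategory containing T(Ob B) ([terminal_idempotent_hull]).

    The enriched content of all this is [pre_unit_mono]: if S is idempotent with
    unit rho, and the unit is invertible at Z, then composition with rho_X is a
    monomorphism from B(SX, Z) to B(X, Z) in V. Equations between maps out of
    SX, and V-naturality itself, can therefore be checked after composing with
    the unit.

    To pass from T(Ob B) to G(Ob C), note that TX = GFX, while GY is a retract
    of TGY = GFGY by a triangle identity, and reflective subcategories are closed
    under retracts ([ob_image_induced_le]). Factoring F -| G through a
    subcategory means by definition that it contains G(Ob C). *)

Set Implicit Arguments.
Unset Strict Implicit.
Unset Printing Implicit Defensive.

Local Opaque post pre.

(** * V-natural transformations *)

Section Enriched.
Variable V : SymMonClosedCategory.

(** [comp_preE], [postM] and [preM] rephrase facts about [ecomp] with the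
    composition of the underlying category as head symbol, so that they can be
    used for rewriting there. *)
Lemma comp_preE (B : VCat V) (X Y Z : underlying B) (g : Hom Y Z) (f : Hom X Y) :
  g ∘ f = pre Z f ∘ (g : Hom tunit (vhom Y Z)).
Proof. exact: ecomp_pre. Qed.

Lemma postM (B : VCat V) (W X Y Z : underlying B) (g : Hom Y Z) (f : Hom X Y) :
  post W (g ∘ f) = post W g ∘ post W f.
Proof. exact: post_comp. Qed.

Lemma preM (B : VCat V) (W X Y Z : underlying B) (g : Hom Y Z) (f : Hom X Y) :
  pre W (g ∘ f) = pre W f ∘ pre W g.
Proof. exact: pre_comp. Qed.

Lemma fmap_fid (A : VCat V) (X Y : A) (f : @Hom (underlying A) X Y) :
  fmap (fid A) f = f.
Proof. by rewrite /fmap /= comp_idl. Qed.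

Lemma inverses_sym (K : Category) (X Y : K) (f : Hom X Y) (g : Hom Y X) :
  inverses f g -> inverses g f.
Proof. by case. Qed.

Lemma vnat_ext (A B : VCat V) (F G : VFunctor A B) (a b : VNat F G) :
  (forall X, a X = b X) -> a = b.
Proof.
case: a b => [a ap] [b bp] /= e.
have {}e : a = b by apply: functional_extensionality_dep.
by subst b; rewrite (proof_irrelevance _ ap bp).
Qed.

Lemma monad_morphism_ext (B : VCat V) (S T : VMonad B) (a b : VMonadMorphism S T) :
  (forall X, a X = b X) -> a = b.
Proof.
case: a b => [a au am] [b bu bm] /= e.
have {}e : a = b by apply: vnat_ext.
subst b.
by rewrite (proof_irrelevance _ au bu) (proof_irrelevance _ am bm).
Qed.

(** Conjugating the V-naturality square of [a] by the inverses on both sides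
    turns it into the square of [b], because [post] and [pre] commute. *)
Lemma inverse_vnatural (A B : VCat V) (F G : VFunctor A B) (a : VNat F G)
    (b : forall X : A, @Hom (underlying B) (G X) (F X)) :
  (forall X, inverses (a X) (b X)) -> forall X Y : A,
  post (G X) (b Y) ∘ fhom G X Y = pre (F Y) (b X) ∘ fhom F X Y.
Proof.
move=> ab X Y; have [baX abX] := ab X; have [baY _] := ab Y.
have -> : fhom G X Y = pre (G Y) (b X) ∘ (post (F X) (a Y) ∘ fhom F X Y).
  by rewrite vnatP -[RHS]comp_assoc -preM abX pre_id comp_idl.
rewrite -[LHS]comp_assoc post_pre [LHS]comp_assoc; congr (_ ∘ _).
by rewrite -[LHS]comp_assoc -postM baY post_id comp_idl.
Qed.

Lemma vnat_pointwise_iso (A B : VCat V) (F G : VFunctor A B) (a : VNat F G)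
    (b : forall X : A, @Hom (underlying B) (G X) (F X)) :
  (forall X, inverses (a X) (b X)) -> vnat_is_iso a.
Proof.
move=> ab; exists (mkVNat (inverse_vnatural ab)).
by split; apply: vnat_ext => X /=; case: (ab X).
Qed.

Lemma unit_natural (B : VCat V) (S : VMonad B) (X Y : B)
    (f : @Hom (underlying B) X Y) :
  munit S Y ∘ f = fmap S f ∘ munit S X.
Proof. by rewrite -vnat_underlying fmap_fid. Qed.

(** * The reflective subcategory of an idempotent monad *)

Section Idempotent.
Variables (B : VCat V) (S : VMonad B).
Hypothesis idemS : idempotent S.

(** The unit at SX is a section of the multiplication at X for every monad;
    here the multiplication is also monic, so that the section is an inverse. *)
Lemma idempotent_unit_mult (X : B) :
  @inverses (underlying B) _ _ (munit S (S X)) (mmult S X).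
Proof.
split; first exact: mmult_unit_l.
case: idemS => b [bm _].
have {}bm : @comp (underlying B) _ _ _ (b X) (mmult S X) = idm _
  by exact: (f_equal (fun a : VNat _ _ => a X) bm).
apply: (comp_cancel_l bm).
by rewrite -comp_assoc mmult_unit_l comp_idl comp_idr.
Qed.

(** Both maps are sections of the multiplication, which is invertible. *)
Lemma idempotent_unit_fmap (X : B) : munit S (S X) = fmap S (munit S X).
Proof.
apply: (comp_cancel_l (proj2 (idempotent_unit_mult X))).
by rewrite mmult_unit_l mmult_unit_r.
Qed.

Lemma assoc_subcat_monad (X : B) : assoc_subcat S (S X).
Proof. by exists (mmult S X); apply: idempotent_unit_mult. Qed.

(** If q is the inverse of the unit at Z, then a left inverse of precomposition
    with the unit at X is the map B(X, Z) -> B(SX, SZ) -> B(SX, Z) given by S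
    and then q. That this is a left inverse follows from the V-naturality of the
    unit, once the unit at SX is identified with the image under S of the unit
    at X. The monomorphism is tested on all maps from an object W of V, not only
    from the tensor unit, so that it can be used to prove V-naturality. *)
Lemma pre_unit_mono (X Z : B) (W : V) (u v : Hom W (vhom (S X) Z)) :
  assoc_subcat S Z -> pre Z (munit S X) ∘ u = pre Z (munit S X) ∘ v -> u = v.
Proof.
case=> q [qZ _].
apply: (@comp_cancel_l _ _ _ _ _ (post (S X) q ∘ fhom S X Z)).
rewrite comp_assoc fhom_pre -idempotent_unit_fmap.
have /= <- := vnatP (munit S) (S X) Z.
by rewrite comp_idr -postM qZ post_id.
Qed.

Lemma comp_unit_inj (X Z : underlying B) (f g : Hom (S X : underlying B) Z) :
  assoc_subcat S Z -> f ∘ munit S X = g ∘ munit S X -> f = g.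
Proof. by move=> PZ; rewrite !comp_preE; apply: pre_unit_mono. Qed.

(** A retraction r of the unit at X is an inverse: the composite of r with the
    unit is an endomorphism of SX that agrees with the identity on the unit. *)
Lemma split_unit_iso (X : underlying B) (r : Hom (S X : underlying B) X) :
  r ∘ munit S X = idm X -> assoc_subcat S X.
Proof.
move=> rX; exists r; split=> //.
apply: comp_unit_inj; first exact: assoc_subcat_monad.
by rewrite comp_assoc rX comp_idl comp_idr.
Qed.

(** If X is a retract of Y and q inverts the unit at Y, then SX -> SY -> Y -> X
    is a retraction of the unit at X. *)
Lemma assoc_subcat_retract (X Y : underlying B) (i : Hom X Y) (r : Hom Y X) :
  r ∘ i = idm X -> assoc_subcat S Y -> assoc_subcat S X.
Proof.
move=> ri [q [qY _]]; apply: (@split_unit_iso _ (r ∘ q ∘ fmap S i)).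
by rewrite !comp_assoc -unit_natural -(comp_assoc q) qY comp_idl.
Qed.

Lemma assoc_subcat_replete : replete (assoc_subcat S).
Proof.
by move=> X Y [f [g [_ fg]]]; apply: (assoc_subcat_retract fg).
Qed.

Lemma assoc_subcat_le (P : B -> Prop) :
  replete P -> subcat_le (ob_image S) P -> subcat_le (assoc_subcat S) P.
Proof.
move=> rP SP X [q inv]; apply: (rP (S X)); last by apply: SP; exists X.
by exists q, (munit S X); apply: inverses_sym.
Qed.

Definition reflector : VFunctor B (fullsub (assoc_subcat S)) :=
  @MkVFunctor V B (fullsub (assoc_subcat S))
    (fun X => exist _ (S X) (assoc_subcat_monad X)) (fun X Y => fhom S X Y)
    (fhom_id S) (fhom_comp S).

(** The reflection is S itself, with the unit of S as unit; the counit at an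
    object Y of the subcategory is the inverse of the unit at Y. *)
Lemma assoc_subcat_reflective : reflective_subcat (assoc_subcat S).
Proof.
split; first exact: assoc_subcat_replete.
exists reflector; constructor.
set i := fullsub_incl _.
(* The counit has to be given as data, while membership in the subcategory only
   asserts that an inverse exists; hence the choice. *)
pose q (Y : fullsub (assoc_subcat S)) := constructive_indefinite_description _ (proj2_sig Y).
have unitP (X Y : B) : post X (munit S Y) ∘ fhom (fid B) X Y
    = pre (S Y) (munit S X) ∘ fhom (fcomp i reflector) X Y.
  by rewrite [fhom (fcomp _ _) _ _]comp_idl (vnatP (munit S) X Y).
(* The unit restricted to the subcategory, where it is pointwise invertible; the
   counit is V-natural as its inverse. *)
have rhoP (X Y : fullsub (assoc_subcat S)) :
    post (i X) (munit S (i Y)) ∘ fhom i X Y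
    = pre (S (i Y)) (munit S (i X)) ∘ fhom (fcomp S i) X Y.
  by rewrite [fhom (fcomp _ _) _ _]comp_idr -(vnatP (munit S) (i X) (i Y)).
pose rho : VNat i (fcomp S i) :=
  @mkVNat V _ B i (fcomp S i) (fun X => munit S (i X)) rhoP.
have rhoK (X : fullsub (assoc_subcat S)) : inverses (rho X) (proj1_sig (q X))
  := proj2_sig (q X).
pose c (Y : fullsub (assoc_subcat S)) :
  @Hom (underlying (fullsub (assoc_subcat S))) (reflector (i Y)) Y := proj1_sig (q Y).
have counitP (X Y : fullsub (assoc_subcat S)) :
    post (reflector (i X)) (c Y) ∘ fhom (fcomp reflector i) X Y
    = pre Y (c X) ∘ fhom (fid _) X Y.
  exact: (inverse_vnatural rhoK X Y).
exists (@mkVNat V B B (fid B) (fcomp i reflector) (munit S) unitP)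
  (@mkVNat V _ _ (fcomp reflector i) (fid _) c counitP).
- move=> X.
  (* Homs of a full subcategory are homs of B, so the first triangle identity
     can be read in B. *)
  change (@comp (underlying B) _ _ _
    (proj1_sig (q (reflector X)) : @Hom (underlying B) (S (S X)) (S X))
    (fmap S (munit S X)) = idm _).
  rewrite -idempotent_unit_fmap.
  exact: (proj1 (proj2_sig (q (reflector X)))).
- move=> Y.
  rewrite /fmap /= comp_idl.
  exact: (proj1 (proj2_sig (q Y))).
Qed.

End Idempotent.

(** * The idempotent monad of a reflective subcategory *)

Section Reflective.
Variables (B : VCat V) (P : B -> Prop) (L : VFunctor B (fullsub P)).
Variable adj : VAdjunction L (fullsub_incl P).

(** One equation is a triangle identity. For the other, the subcategory being
    full, the unit at Y is a morphism of the subcategory; naturality of the counit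
    with respect to it rewrites unit after counit as the left-hand side of the
    other triangle identity, at Y. *)
Lemma incl_unit_counit (Y : fullsub P) :
  @inverses (underlying B) _ _ (adj_unit adj (proj1_sig Y)) (adj_counit adj Y).
Proof.
split.
  have := adj_triangle_r adj Y.
  by rewrite {1}/fmap [fhom (fullsub_incl P) _ _ ∘ _]comp_idl.
have := vnat_underlying (adj_counit adj)
  (adj_unit adj (proj1_sig Y) : @Hom (underlying (fullsub P)) Y (L (proj1_sig Y))).
rewrite fmap_fid fmap_fcomp.
have -> f : fmap (fullsub_incl P) (X := Y) (Y := L (proj1_sig Y)) f = f.
  by rewrite /fmap /= comp_idl.
by move=> e; apply: etrans (esym e) (adj_triangle_l adj _).
Qed.

(** The multiplication is the counit at objects of the form LX, inverted by the
    unit. *)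
Lemma induced_idempotent : idempotent (induced_monad adj).
Proof.
apply: (vnat_pointwise_iso (a := mmult (induced_monad adj))
  (b := fun X => adj_unit adj (proj1_sig (L X)))) => X.
have /inverses_sym := incl_unit_counit (L X).
by rewrite /= {1}/fmap [fhom (fullsub_incl P) _ _ ∘ _]comp_idl.
Qed.

Lemma assoc_subcat_induced (X : B) : replete P ->
  assoc_subcat (induced_monad adj) X <-> P X.
Proof.
move=> rP; split.
  case=> q inv; apply: (rP (proj1_sig (L X))); last exact: proj2_sig.
  by exists q, (adj_unit adj X); apply: inverses_sym.
by move=> PX; exists (adj_counit adj (exist _ X PX)); apply: (incl_unit_counit (exist _ X PX)).
Qed.

End Reflective.

Lemma reflective_subcat_monad (B : VCat V) (P : B -> Prop) :
  reflective_subcat P ->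
  exists2 S : VMonad B, idempotent S & forall X, assoc_subcat S X <-> P X.
Proof.
case=> rP [L [adj]]; exists (induced_monad adj); first exact: induced_idempotent.
by move=> X; apply: assoc_subcat_induced.
Qed.

Lemma reflective_subcat_retract (B : VCat V) (P : B -> Prop)
    (X Y : underlying B) (i : Hom X Y) (r : Hom Y X) :
  reflective_subcat P -> r ∘ i = idm X -> P Y -> P X.
Proof.
case/reflective_subcat_monad=> S idemS SP ri /SP PY.
by apply/SP; apply: (assoc_subcat_retract idemS ri).
Qed.

(** * Morphisms out of an idempotent monad *)

Section Morphisms.
Variables (B : VCat V) (S T : VMonad B).
Hypothesis idemS : idempotent S.

(** A morphism from S to T makes each TX an S-algebra, through STX -> TTX -> TX,
    and the structure map of an algebra is a retraction of the unit. *)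
Lemma monad_morphism_ob_image :
  VMonadMorphism S T -> subcat_le (ob_image T) (assoc_subcat S).
Proof.
move=> alpha _ [X ->].
apply: (split_unit_iso idemS (r := (mmult T X : @Hom (underlying B) _ _) ∘ alpha (T X))).
by rewrite comp_assoc mmor_unit mmult_unit_l.
Qed.

(** Only compatibility with the units is asked for, so that uniqueness applies
    to composites without first making them morphisms of monads. *)
Lemma vnat_unit_unique (a b : VNat S T) :
  subcat_le (ob_image T) (assoc_subcat S) ->
  (forall X, a X ∘ munit S X = munit T X) ->
  (forall X, b X ∘ munit S X = munit T X) -> a = b.
Proof.
move=> TS aE bE; apply: vnat_ext => X.
by apply: (comp_unit_inj idemS); [apply: TS; exists X | rewrite aE bE].
Qed.

(** The component at X is forced: it is the extension of the unit of T along the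
    unit of S, that is S applied to the unit of T followed by the inverse of the
    unit of S at TX. V-naturality and compatibility with the multiplications then
    hold since they hold after composing with the units of S. *)
Lemma monad_morphism_exists :
  subcat_le (ob_image T) (assoc_subcat S) -> inhabited (VMonadMorphism S T).
Proof.
move=> TS.
have TX (X : B) : assoc_subcat S (T X) by apply: TS; exists X.
pose q (X : B) := constructive_indefinite_description _ (TX X).
pose a (X : B) : @Hom (underlying B) (S X) (T X) :=
  (proj1_sig (q X) : @Hom (underlying B) _ _) ∘ fmap S (munit T X).
have aE X : a X ∘ munit S X = munit T X.
  have [e _] := proj2_sig (q X).
  by rewrite /a comp_assoc -unit_natural -comp_assoc e comp_idl.
have aP X Y : post (S X) (a Y) ∘ fhom S X Y = pre (T Y) (a X) ∘ fhom T X Y.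
  apply: (pre_unit_mono idemS) => //.
  rewrite -[RHS]comp_assoc -preM aE -(vnatP (munit T)).
  rewrite -[LHS]comp_assoc -post_pre [LHS]comp_assoc -(vnatP (munit S)).
  by rewrite -[LHS]comp_assoc -postM aE.
(* The body of [a] is hidden because rewriting with associativity would
   otherwise see through it. *)
clearbody a; have nE X : mkVNat aP X = a X by [].
constructor; exists (mkVNat aP) => X; first exact: aE.
(* Maps from SSX to TX are compared after composing with two units. *)
rewrite !nE; do 2 apply: (comp_unit_inj idemS) => //.
rewrite [_ ∘ mmult S X ∘ _]comp_assoc mmult_unit_l comp_idr aE.
rewrite !comp_assoc -(comp_assoc (a (S X))) aE.
rewrite -(comp_assoc (fmap T (a X))) -unit_natural comp_assoc aE.
by rewrite -comp_assoc mmult_unit_l comp_idl.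
Qed.

End Morphisms.

(** * Terminal idempotent monads and reflective hulls *)

(** Existence of morphisms translates the two universal properties into each
    other; the uniqueness required of a factorization through T' comes for free,
    as there is at most one morphism out of an idempotent monad. *)
Lemma terminal_idempotent_hull (B : VCat V) (T T' : VMonad B) :
  idempotent T' ->
  terminal_idempotent T T' <-> reflective_hull (ob_image T) (assoc_subcat T').
Proof.
move=> idemT'; split.
- case=> _ [iota iotaU]; split.
  + exact: assoc_subcat_reflective.
  + exact: (monad_morphism_ob_image _ iota).
  + move=> Q reflQ TQ; have [S idemS SQ] := reflective_subcat_monad reflQ.
    have [|alpha] := @monad_morphism_exists _ S T idemS.
      by move=> X /TQ /SQ.
    have [alpha' _] := iotaU S alpha idemS.
    apply: assoc_subcat_le; first by case: reflQ.
    by move=> X /(monad_morphism_ob_image idemS alpha') /SQ.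
- case=> _ TT' minT'; split=> //.
  have [iota] := monad_morphism_exists idemT' TT'.
  exists iota => S alpha idemS.
  have T'S : subcat_le (ob_image T') (assoc_subcat S).
    have le : subcat_le (assoc_subcat T') (assoc_subcat S).
      apply: minT'; first exact: assoc_subcat_reflective.
      exact: (monad_morphism_ob_image _ alpha).
    by move=> _ [X ->]; apply: le; apply: assoc_subcat_monad.
  have [alpha'] := monad_morphism_exists idemS T'S.
  exists alpha'; split.
    apply: (vnat_unit_unique idemS) => [|X|X]; first exact: (monad_morphism_ob_image _ alpha).
      rewrite -(mmor_unit iota) -(mmor_unit alpha'); exact: comp_assoc.
    exact: mmor_unit.
  move=> beta _; apply: monad_morphism_ext => X.
  by rewrite (@vnat_unit_unique _ S T' idemS alpha' beta T'S) //; apply: mmor_unit.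
Qed.

(** Unit and counit exhibit GY as a retract of GFGY, which is the value of the
    induced monad at GY. *)
Lemma ob_image_induced_le (B C : VCat V) (F : VFunctor B C) (G : VFunctor C B)
    (adj : VAdjunction F G) (Q : B -> Prop) : reflective_subcat Q ->
  subcat_le (ob_image (induced_monad adj)) Q <-> subcat_le (ob_image G) Q.
Proof.
move=> reflQ; split=> le _ [Y ->]; last by apply: le; exists (F Y).
apply: (reflective_subcat_retract reflQ (adj_triangle_r adj Y)).
by apply: le; exists (G Y).
Qed.

Lemma reflective_hull_congr (B : VCat V) (S S' P : B -> Prop) :
  (forall Q, reflective_subcat Q -> subcat_le S Q <-> subcat_le S' Q) ->
  reflective_hull S P <-> reflective_hull S' P.
Proof.
move=> SS'; split=> -[reflP SP minP]; split=> // [|Q reflQ /(SS' _ reflQ)].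
- exact/SS'.
- exact: minP.
- exact/SS'.
- exact: minP.
Qed.

Lemma reflective_hull_eq (B : VCat V) (S P P' : B -> Prop) :
  reflective_subcat P' -> (forall X, P' X <-> P X) ->
  reflective_hull S P -> reflective_hull S P'.
Proof.
move=> reflP' P'P [_ SP minP]; split=> // [X /SP /P'P //|Q reflQ SQ X /P'P].
exact: minP.
Qed.

(** A hull need not be given as the subcategory of a monad, so a monad is
    recovered from it first. *)
Lemma exists_terminal_idempotent (B : VCat V) (T : VMonad B) :
  (exists T' : VMonad B, terminal_idempotent T T')
  <-> (exists P : B -> Prop, reflective_hull (ob_image T) P).
Proof.
split=> [[T' termT']|[P hullP]].
  by exists (assoc_subcat T'); apply/terminal_idempotent_hull => //; case: termT'.
have [reflP _ _] := hullP; have [S idemS SP] := reflective_subcat_monad reflP.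
exists S; apply/terminal_idempotent_hull => //.
by apply: reflective_hull_eq hullP => //; apply: assoc_subcat_reflective.
Qed.

Lemma smallest_factoring_hull (B C : VCat V) (F : VFunctor B C) (G : VFunctor C B)
    (adj : VAdjunction F G) (P : B -> Prop) :
  smallest_factoring adj P <-> reflective_hull (ob_image G) P.
Proof.
have le Q : factors_through adj Q <-> subcat_le (ob_image G) Q.
  by split=> [h _ [Y ->] //|h Y]; apply: h; exists Y.
split=> -[reflP GP minP]; split=> // [|Q reflQ /le GQ]; try exact/le.
- exact: minP.
- exact: minP.
Qed.

End Enriched.

Theorem theorem4p12 (V : SymMonClosedCategory) (B : VCat V) (T : VMonad B)
    (C : VCat V) (F : VFunctor B C) (G : VFunctor C B) (adj : VAdjunction F G)
    (adj_induces_T : induced_monad adj = T) :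
  (((exists T' : VMonad B, terminal_idempotent T T')
      <-> (exists P : B -> Prop, reflective_hull (ob_image T) P))
   /\ ((exists P : B -> Prop, reflective_hull (ob_image T) P)
      <-> (exists P : B -> Prop, reflective_hull (ob_image G) P))
   /\ ((exists P : B -> Prop, reflective_hull (ob_image G) P)
      <-> (exists P : B -> Prop, smallest_factoring adj P)))
  /\
  (forall T' : VMonad B, idempotent T' ->
     (terminal_idempotent T T' <-> reflective_hull (ob_image T) (assoc_subcat T'))
     /\ (terminal_idempotent T T' <-> reflective_hull (ob_image G) (assoc_subcat T'))
     /\ (terminal_idempotent T T' <-> smallest_factoring adj (assoc_subcat T'))).
Proof.
have hullTG P : reflective_hull (ob_image T) P <-> reflective_hull (ob_image G) P.
  by rewrite -adj_induces_T; apply/reflective_hull_congr/ob_image_induced_le.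
split; first split; [exact: exists_terminal_idempotent | split |].
- by split=> -[P hullP]; exists P; apply/hullTG.
- by split=> -[P hullP]; exists P; apply/(smallest_factoring_hull adj).
- move=> T' idemT'.
  have termT' := terminal_idempotent_hull T idemT'.
  have factT' := smallest_factoring_hull adj (assoc_subcat T').
  have hullT' := hullTG (assoc_subcat T').
  by tauto.
Qed.
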